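(* Let $A\subset\mathbb{R}$ be a finite set. Then for all but at most one value $x\in\mathbb{R}$, $$|(A+A)(A+x)|\gg \frac{|A|^{11/7}}{(\log|A|)^{3/7}},$$ where $(A+A)(A+x)=\{(b+c)(d+x): b,c,d\in A\}$.
   Context: $X\gg Y$ means $X\geq cY$ for some absolute constant $c>0$ (independent of $A$ and $x$). Logarithms are to base 2. *)

(* Defs.v *)
From HB Require Import structures.
From mathcomp Require Import all_boot all_order all_algebra.
From mathcomp Require Import finmap.
From mathcomp Require Import reals exp.
Set Implicit Arguments. Unset Strict Implicit. Unset Printing Implicit Defensive.
Import Order.TTheory GRing.Theory Num.Theory.
Local Open Scope ring_scope.
Local Open Scope fset_scope.

Definition sumset (R : realType) (A B : {fset R}) : {fset R} :=
  [fset (a + b)%R | a : R in A, b : R in B].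
Definition shift (R : realType) (A : {fset R}) (x : R) : {fset R} :=
  [fset (a + x)%R | a : R in A].
Definition prodset (R : realType) (S T : {fset R}) : {fset R} :=
  [fset (s * t)%R | s : R in S, t : R in T].
Definition log2 (R : realType) (y : R) : R := ln y / ln 2.

(* Main.v *)
(* Write n = |A|, S = A + A and let M bound the product sets of two distinct shifts x and y;
   it suffices to show n^11 << M^7 log n. Put U = (A + x) \ {0} and let X_t be the set of
   quotients with at least t representations in U / U. By Cauchy-Schwarz, n^6 << M N, where N
   counts the solutions of u (b + c) = u' (b' + c'), and N is the sum over t of the number of
   solutions of b + c = r (b' + c') with r in X_t. The Szemeredi-Trotter theorem bounds the
   latter by O(n^3 |X_t|^(1/2)), so n^3 << M sum_t |X_t|^(1/2).
   Solymosi's argument gives |X_t| << |S|^2 / t^2, hence n^3 << M |S| log n. On the other hand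
   s (r u + y - x) lies in the product set of the shift y whenever r u is in U and s in S,
   so Szemeredi-Trotter gives |X_t| << n^2 M^2 / (|S| t^3); with |X_t| <= n^2 / t this yields
   n^8 |S| << M^6. Multiply the two bounds.
   All point sets involved are Cartesian products, for which Szemeredi-Trotter has an
   elementary proof. *)
Require Import Defs.
From HB Require Import structures.
From mathcomp Require Import all_boot all_order all_algebra.
From mathcomp Require Import finmap.
From mathcomp Require Import boolp reals exp.
From mathcomp Require Import zify ring lra.
Set Implicit Arguments. Unset Strict Implicit. Unset Printing Implicit Defensive.
Import Order.TTheory GRing.Theory Num.Theory.
Local Open Scope ring_scope.
Local Open Scope fset_scope.
Local Open Scope ring_scope.

(** * Counting *)

Lemma count_le_inj (T T' : eqType) (s : seq T) (s' : seq T') (P : pred T) (Q : pred T')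
    (f : T -> T') :
  uniq s ->
  {in [pred x in s | P x] &, injective f} ->
  (forall x, x \in s -> P x -> (f x \in s') && Q (f x)) ->
  (count P s <= count Q s')%N.
Proof.
move=> us injf fs; rewrite -!size_filter -(size_map f); apply: uniq_leq_size.
  rewrite map_inj_in_uniq ?filter_uniq //; move=> x y.
  by rewrite !mem_filter => /andP[Px xs] /andP[Py ys]; apply: injf; rewrite !inE ?xs ?ys.
by move=> v /mapP[x]; rewrite mem_filter => /andP[Px xs] ->; rewrite mem_filter andbC fs.
Qed.

Lemma exchange_count (T T' : Type) (s : seq T) (s' : seq T') (P : T -> T' -> bool) :
  (\sum_(x <- s) count (P x) s' = \sum_(y <- s') count (P^~ y) s)%N.
Proof.
under eq_bigr do rewrite -sum1_count big_mkcond.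
by rewrite exchange_big; apply: eq_bigr => y _; rewrite -sum1_count [in RHS]big_mkcond.
Qed.

(** Pigeonhole: an element whose value recurs later in [s] takes part in a collision, and the
    remaining ones have distinct values, at most [N] of them. *)
Lemma size_le_collisions (T : eqType) (s : seq T) (f : T -> nat) (N : nat) :
  uniq s -> {in s, forall x, (f x < N)%N} ->
  (size s <= \sum_(x <- s) count (fun y => (x != y) && (f x == f y)) s + N)%N.
Proof.
move=> us fN; have H : (size (undup (map f s)) <= N)%N.
  rewrite -(size_iota 0 N); apply: uniq_leq_size; first exact: undup_uniq.
  by move=> v; rewrite mem_undup => /mapP[x xs ->]; rewrite mem_iota fN.
apply: leq_trans (leq_add (leqnn _) H) => {H fN N}.
elim: s us => [|x s IH] //= /andP[xs us]; rewrite big_cons /= eqxx /=.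
have /IH {}IH := us.
rewrite add0n; set c := count _ s.
rewrite big_split /=; set S1 := bigop.body _ s _; set S2 := bigop.body _ s _ in IH *.
move: IH => /= IH.
case: ifP => [/mapP[y ys fxy]|_] /=; last by lia.
suff : (0 < c)%N by lia.
rewrite -has_count; apply/hasP; exists y => //; rewrite fxy eqxx andbT.
by apply: contraNneq xs => ->.
Qed.

(** * Szemeredi-Trotter on grids *)

Section Rank.
Variables (R : realDomainType).
Implicit Types (A : {fset R}).

(** Dividing the rank by [q] cuts the line into cells with at most [q] points of [A] each. Points
    outside [A] have a rank too, so the cell index is monotone on the whole line. *)
Definition rank A (x : R) : nat := count (fun a => a < x) A.

Lemma rank_mono A : {homo rank A : x y / x <= y >-> (x <= y)%N}.
Proof. by move=> x y xy; apply: sub_count => a /lt_le_trans; apply. Qed.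

Lemma rank_strict A x y : x \in A -> x < y -> (rank A x < rank A y)%N.
Proof.
move=> xA xy; rewrite /rank.
have /permP P : perm_eq A (x :: rem x A) by apply: perm_to_rem.
rewrite !P /= ltxx xy add0n add1n ltnS.
by apply: sub_count => a /lt_trans; apply.
Qed.

Lemma rank_inj A : {in A &, injective (rank A)}.
Proof.
move=> x y xA yA e.
by case: (ltgtP x y) => // [/(rank_strict xA)|/(rank_strict yA)]; rewrite e ltnn.
Qed.

Lemma rank_lt A x : x \in A -> (rank A x < #|` A|)%N.
Proof.
move=> xA; rewrite /rank -(count_predT A).
have /permP P : perm_eq A (x :: rem x A) by apply: perm_to_rem.
by rewrite !P /= ltxx add0n add1n ltnS; apply: sub_count.
Qed.

(** The rank is injective on [A], and within one cell it stays in a window of [q] consecutive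
    integers. *)
Lemma count_same_cell A q x : (0 < q)%N ->
  (count (fun y => rank A x %/ q == rank A y %/ q) A <= q)%N.
Proof.
move=> q0; set v := (rank A x %/ q)%N.
rewrite -[leqRHS](size_iota (v * q) q) -count_predT.
apply: (@count_le_inj _ _ _ _ _ _ (rank A)).
- exact: fset_uniq.
- by move=> y z; rewrite !inE => /andP[yA _] /andP[zA _]; apply: rank_inj.
move=> y yA /eqP e; rewrite andbT mem_iota e leq_trunc_div /=.
by rewrite {1}(divn_eq (rank A y) q) ltn_add2l ltn_mod.
Qed.

End Rank.

Lemma count_pairs (T T' : Type) (s : seq T) (s' : seq T') (P : T -> T' -> bool) :
  count (fun p => P p.1 p.2) [seq (x, y) | x <- s, y <- s'] = \sum_(x <- s) count (P x) s'.
Proof.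
rewrite -sum1_count big_mkcond big_allpairs; apply: eq_bigr => x _.
by rewrite -sum1_count [in RHS]big_mkcond.
Qed.

Lemma leq_sum_seq (T : eqType) (s : seq T) (F G : T -> nat) :
  (forall x, x \in s -> (F x <= G x)%N) -> (\sum_(x <- s) F x <= \sum_(x <- s) G x)%N.
Proof. by move=> FG; rewrite big_seq [leqRHS]big_seq; apply: leq_sum. Qed.

Lemma sum_seq_le_const (T : eqType) (s : seq T) (F : T -> nat) (c : nat) :
  (forall x, x \in s -> (F x <= c)%N) -> (\sum_(x <- s) F x <= size s * c)%N.
Proof.
move=> Fc; apply: leq_trans (leq_sum_seq (G := fun=> c) Fc) _.
by rewrite big_const_seq count_predT iter_addn_0 mulnC.
Qed.

Section RichLines.
Variables (R : realFieldType) (A B : {fset R}).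

(** Along an increasing graph neither cell index can decrease, so their sum alone identifies the
    cell. *)
Lemma monotone_same_cell (c1 c2 : R -> nat) (g : R -> R) (x y : R) :
  {homo c1 : u v / u <= v >-> (u <= v)%N} ->
  {homo c2 : u v / u <= v >-> (u <= v)%N} ->
  {homo g : u v / u <= v} ->
  (c1 x + c2 (g x) = c1 y + c2 (g y))%N -> c1 x = c1 y /\ c2 (g x) = c2 (g y).
Proof.
move=> h1 h2 hg e; have [xy|/ltW xy] := leP x y.
  by have := h1 _ _ xy; have := h2 _ _ (hg _ _ xy); lia.
by have := h1 _ _ xy; have := h2 _ _ (hg _ _ xy); lia.
Qed.

(** Along a decreasing graph the reflected index [N - c2] increases instead; the bounds by [N] keep
    the truncated subtraction faithful. *)
Lemma antitone_same_cell (c1 c2 : R -> nat) (N : nat) (g : R -> R) (x y : R) :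
  {homo c1 : u v / u <= v >-> (u <= v)%N} ->
  {homo c2 : u v / u <= v >-> (u <= v)%N} ->
  {homo g : u v /~ u <= v} ->
  (c2 (g x) <= N)%N -> (c2 (g y) <= N)%N ->
  (c1 x + (N - c2 (g x)) = c1 y + (N - c2 (g y)))%N ->
  c1 x = c1 y /\ c2 (g x) = c2 (g y).
Proof.
move=> h1 h2 hg lx ly e; have [xy|/ltW xy] := leP x y.
  by have := h1 _ _ xy; have := h2 _ _ (hg _ _ xy); lia.
by have := h1 _ _ xy; have := h2 _ _ (hg _ _ xy); lia.
Qed.

(** The line is strictly monotone, so one integer, at most the sum of the largest column and row
    indices, identifies each cell it meets. Pigeonhole on that integer gives the claim. *)
Lemma cell_collisions (qA qB : nat) (m c : R) :
  m != 0 -> (0 < qA)%N -> (0 < qB)%N ->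
  (count (fun x => (m * x + c)%R \in B) A <=
   \sum_(x <- A) count (fun y => [&& x != y, (m * x + c)%R \in B, (m * y + c)%R \in B,
       rank A x %/ qA == rank A y %/ qA &
       rank B (m * x + c)%R %/ qB == rank B (m * y + c)%R %/ qB]) A
   + ((#|` A|.-1 %/ qA) + (#|` B|.-1 %/ qB)).+1)%N.
Proof.
move=> m0 qA0 qB0; set N := (#|` B|.-1 %/ qB)%N.
pose c1 x := (rank A x %/ qA)%N; pose c2 y := (rank B y %/ qB)%N.
pose g x := m * x + c.
have h1 : {homo c1 : u v / u <= v >-> (u <= v)%N}.
  by move=> u v uv; apply/leq_div2r/rank_mono.
have h2 : {homo c2 : u v / u <= v >-> (u <= v)%N}.
  by move=> u v uv; apply/leq_div2r/rank_mono.
have l1 x : x \in A -> (c1 x <= #|` A|.-1 %/ qA)%N.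
  by move=> /rank_lt xA; apply: leq_div2r; rewrite -ltnS prednK // (leq_ltn_trans _ xA).
have l2 y : y \in B -> (c2 y <= N)%N.
  by move=> /rank_lt yB; apply: leq_div2r; rewrite -ltnS prednK // (leq_ltn_trans _ yB).
pose phi x := (c1 x + (if (0 < m)%R then c2 (g x) else N - c2 (g x)))%N.
rewrite -size_filter; set D := filter _ _.
have DP x : x \in D -> x \in A /\ g x \in B by rewrite mem_filter => /andP[].
apply: leq_trans (@size_le_collisions _ D phi (#|` A|.-1 %/ qA + N).+1 _ _) _; last 2 first.
- by move=> x /DP[xA xB]; rewrite /phi ltnS leq_add ?l1 //; case: ifP => _; rewrite ?l2 ?leq_subr.
- rewrite leq_add2r.
  rewrite big_filter big_mkcond; apply: leq_sum => x _.
  case: ifP => // gx; rewrite count_filter; apply: sub_count => y /= /andP[/andP[-> /eqP e] gy].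
  rewrite gy /=; suff [] : c1 x = c1 y /\ c2 (g x) = c2 (g y).
    by rewrite /c1 /c2 /g => -> ->; rewrite !eqxx.
  move: e; rewrite /phi; case: ltP => [mp|mn].
    by apply: monotone_same_cell => // u v uv; rewrite /g lerD2r ler_pM2l.
  apply: antitone_same_cell => //; rewrite ?l2 // => u v uv.
  by rewrite /g lerD2r ler_nM2l // lt_neqAle m0.
by rewrite filter_uniq ?fset_uniq.
Qed.

(* Cut the grid into cells along quantiles; a line which is
   monotone meets few cells, so most of its points share a cell with another one, whereas
   the grid has few pairs of points in a common cell and each pair determines the line. *)
Lemma rich_lines (L : {fset R * R}) (k : nat) : (1 < k)%N ->
  (forall l, l \in L -> l.1 != 0 /\ (k <= count (fun x => (l.1 * x + l.2)%R \in B) A)%N) ->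
  (#|` L| * k ^ 3 <= 180 * (#|` A| ^ 2 * #|` B| ^ 2))%N.
Proof.
move=> k1 HL; have [->|/fset0Pn[l0 /HL[l00 l0k]]] := eqVneq L fset0.
  by rewrite cardfs0.
have kn : (k <= #|` A|)%N by apply: leq_trans l0k (count_size _ _).
have km : (k <= #|` B|)%N.
  apply: leq_trans l0k _; rewrite -count_predT.
  apply: (@count_le_inj _ _ _ _ _ _ (fun x => l0.1 * x + l0.2)); first exact: fset_uniq.
    by move=> x y _ _ /addIr /(mulfI l00).
  by move=> x _ ->.
set n := #|` A| in kn *; set m := #|` B| in km *.
(* As [k <= n] and [k <= m], rounding costs less than [n] and [m], so each largest cell index is at
   most [(k - 1) / 7]. A line then has at least [k - 2 (k - 1) / 7 - 1] collisions, which is at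
   least [5 k / 14] for [k >= 2]. *)
pose qA := (8 * n %/ k)%N; pose qB := (8 * m %/ k)%N.
have qAk : (qA * k <= 8 * n)%N by apply: leq_trunc_div.
have qBk : (qB * k <= 8 * m)%N by apply: leq_trunc_div.
have qAk' : (7 * n + 1 <= qA * k)%N.
  by have := divn_eq (8 * n) k; have := ltn_mod (8 * n) k; rewrite -/qA; lia.
have qBk' : (7 * m + 1 <= qB * k)%N.
  by have := divn_eq (8 * m) k; have := ltn_mod (8 * m) k; rewrite -/qB; lia.
have qA0 : (0 < qA)%N by nia.
have qB0 : (0 < qB)%N by nia.
have cA : (7 * (n.-1 %/ qA) < k)%N by have := leq_trunc_div n.-1 qA; nia.
have cB : (7 * (m.-1 %/ qB) < k)%N by have := leq_trunc_div m.-1 qB; nia.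
pose F (l : R * R) x y := [&& x != y, (l.1 * x + l.2)%R \in B, (l.1 * y + l.2)%R \in B,
       rank A x %/ qA == rank A y %/ qA &
       rank B (l.1 * x + l.2)%R %/ qB == rank B (l.1 * y + l.2)%R %/ qB]%N.
have lower l : l \in L -> (5 * k <= 14 * \sum_(x <- A) count (F l x) A)%N.
  move=> /HL[l1 lk]; have := cell_collisions l.2 l1 qA0 qB0.
  by rewrite -/n -/m -/(F l); move: (\sum_(x <- A) _)%N => s; lia.
have total : (#|` L| * (5 * k) <= 14 * \sum_(l <- L) \sum_(x <- A) count (F l x) A)%N.
  rewrite big_distrr /=; apply: leq_trans (leq_sum_seq lower).
  by rewrite big_const_seq count_predT iter_addn_0 mulnC.
(* Two points with distinct abscissas determine the line, so the lines are at most as many as the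
   pairs of heights sharing a cell of [B]. *)
have inner x y : (count (fun l => F l x y) L <=
    (rank A x %/ qA == rank A y %/ qA) * (m * qB))%N.
  have [e|ne] := eqVneq (rank A x %/ qA)%N (rank A y %/ qA)%N; last first.
    rewrite mul0n leqn0 -leqn0 leqNgt -has_count; apply/hasPn => l _.
    by rewrite /F (negPf ne) /= !andbF.
  rewrite mul1n.
  apply: leq_trans (_ : (\sum_(u <- B)
      count (fun v => rank B u %/ qB == rank B v %/ qB) B <= _)%N); last first.
    by apply: sum_seq_le_const => u _; apply: count_same_cell.
  rewrite -(count_pairs B B (fun u v => rank B u %/ qB == rank B v %/ qB)%N).
  apply: (@count_le_inj _ _ _ _ _ _ (fun l => (l.1 * x + l.2, l.1 * y + l.2))).
  - exact: fset_uniq.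
  - move=> [a b] [a' b']; rewrite !inE /F /= => /andP[_ /andP[xy _]] _ [e1 e2].
    have /(mulIf _) aa' : a * (x - y) = a' * (x - y).
      by rewrite !mulrBr; apply/eqP; rewrite subr_eq addrAC -subr_eq; apply/eqP; lra.
    by rewrite subr_eq0 in aa'; move: e1; rewrite aa' // => /addrI ->.
  - by move=> l _ /and5P[_ lx ly _ e2]; rewrite allpairs_f //= e2.
have upper : (\sum_(l <- L) \sum_(x <- A) count (F l x) A <= n * (qA * (m * qB)))%N.
  rewrite exchange_big /=; apply: sum_seq_le_const => x xA.
  rewrite (exchange_count L A (fun l y => F l x y)).
  apply: leq_trans (leq_sum_seq (fun y _ => inner x y)) _.
  rewrite -big_distrl leq_mul2r; apply/orP; right.
  apply: leq_trans (count_same_cell A x qA0).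
  by rewrite -sum1_count [leqRHS]big_mkcond; apply: leq_sum => y _; case: eqP.
have : (#|` L| * (5 * k) <= 14 * (n * (qA * (m * qB))))%N.
  by apply: leq_trans total _; rewrite leq_mul2l upper.
move: (#|` L|) => s {total upper lower inner} H.
(* Multiplying by [k ^ 2] turns the cell sizes into [qA * k <= 8 n] and [qB * k <= 8 m]; then
   [14 * 64 = 896 <= 5 * 180] yields the constant. *)
have H2 : (s * (5 * k) * k ^ 2 <= 14 * (n * m * (8 * n) * (8 * m)))%N.
  apply: leq_trans (_ : 14 * (n * m * (qA * k) * (qB * k)) <= _)%N.
    have -> : (14 * (n * m * (qA * k) * (qB * k)) = 14 * (n * (qA * (m * qB))) * k ^ 2)%N.
      by ring.
    by rewrite leq_mul2r H orbT.
  by rewrite leq_mul2l /= leq_mul // leq_mul.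
have e1 : (s * (5 * k) * k ^ 2 = 5 * (s * k ^ 3))%N by ring.
have e2 : (14 * (n * m * (8 * n) * (8 * m)) = 896 * (n ^ 2 * m ^ 2))%N by ring.
lia.
Qed.

End RichLines.

(** * Solymosi's bound on rich slopes *)

Section Solymosi.
Variables (R : realFieldType) (U S : {fset R}).
Hypothesis addUS : {in U &, forall u v, u + v \in S}.

(** The slope of [p] lies strictly between [r] and [r']. Multiplying by the abscissa avoids a
    division and treats both half-planes at once. *)
Let wedge (r r' : R) (p : R * R) := (0 < (p.2 - r * p.1) * p.1) && (0 < (r' * p.1 - p.2) * p.1).

(** Add [(u, r u)] to [(v, r' v)]: the directions are independent, so the sum determines [u] and
    [v]; these have the same sign, so the sum falls between the two lines. *)
Lemma wedge_pairs (V : {fset R}) (r r' : R) (h : nat) :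
  {subset V <= U} -> {in V &, forall u v, 0 < u * v} -> r < r' ->
  (h <= count (fun u => (r * u)%R \in U) V)%N ->
  (h <= count (fun u => (r' * u)%R \in U) V)%N ->
  (h ^ 2 <= count (wedge r r') [seq (p, q) | p <- S, q <- S])%N.
Proof.
move=> VU Vpos rr' hr hr'.
have h2 : (h ^ 2 <= count (fun p => ((r * p.1)%R \in U) && ((r' * p.2)%R \in U))
    [seq (u, v) | u <- V, v <- V])%N.
  rewrite (count_pairs V V (fun u v => ((r * u)%R \in U) && ((r' * v)%R \in U))).
  apply: leq_trans
    (_ : \sum_(u <- V) ((r * u)%R \in U) * count (fun v => (r' * v)%R \in U) V <= _)%N.
    rewrite -big_distrl /= -mulnn leq_mul //; move: hr.
    by rewrite -sum1_count big_mkcond.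
  by apply: leq_sum => u _; case: (_ \in U); rewrite ?mul0n ?mul1n.
apply: leq_trans h2 _.
apply: (@count_le_inj _ _ _ _ _ _ (fun p => (p.1 + p.2, r * p.1 + r' * p.2))).
- by apply: allpairs_uniq; rewrite ?fset_uniq // => -[? ?] [? ?].
- move=> [u v] [u' v'] _ _ /= [e1 e2].
  have /(mulfI _) vv' : (r' - r) * v = (r' - r) * v'.
    have e3 : r * (u + v) = r * (u' + v') by rewrite e1.
    rewrite !mulrBl; rewrite !mulrDr in e3; lra.
  have vv : v = v' by apply: vv'; rewrite subr_eq0 gt_eqF.
  by move: e1; rewrite vv => /addIr ->.
- move=> p /allpairsP[[u v] [/= uV vV ->]] /= /andP[ru rv]; apply/andP; split.
    by rewrite allpairs_f // addUS // VU.
  have uv := Vpos _ _ uV vV; have uu := Vpos _ _ uV uV; have vv := Vpos _ _ vV vV.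
  have d : 0 < r' - r by rewrite subr_gt0.
  rewrite /wedge /=; apply/andP; split.
    have -> : (r * u + r' * v - r * (u + v)) * (u + v) = (r' - r) * (u * v + v * v) by ring.
    by rewrite mulr_gt0 // addr_gt0.
  have -> : (r' * (u + v) - (r * u + r' * v)) * (u + v) = (r' - r) * (u * v + u * u) by ring.
  by rewrite mulr_gt0 // addr_gt0.
Qed.

(* Vector sums of points on two consecutive lines through the origin lie strictly
   between these lines, so different consecutive pairs yield disjoint sets of sums. *)
Lemma rich_slopes_half (V X : {fset R}) (h : nat) :
  {subset V <= U} -> {in V &, forall u v, 0 < u * v} ->
  (forall r, r \in X -> h <= count (fun u => (r * u)%R \in U) V)%N ->
  ((#|` X| - 1) * h ^ 2 <= #|` S| ^ 2)%N.
Proof.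
move=> VU Vpos Xh; pose s := sort <=%R X; pose r i := nth 0 s i.
have szs : size s = #|` X| by rewrite size_sort.
have ss : sorted <%R s by rewrite sort_lt_sorted fset_uniq.
have rmono i j : (i < j)%N -> (j < #|` X|)%N -> r i < r j.
  by move=> ij jX; apply: (sorted_ltn_nth lt_trans) => //; rewrite inE szs // (ltn_trans ij).
have rX i : (i < #|` X|)%N -> r i \in X.
  by move=> iX; rewrite -(mem_sort <=%R) mem_nth // szs.
have -> : ((#|` X| - 1) * h ^ 2 = \sum_(i <- iota 0 (#|` X| - 1)) h ^ 2)%N.
  by rewrite big_const_seq count_predT size_iota iter_addn_0 mulnC.
apply: leq_trans (_ : \sum_(i <- iota 0 (#|` X| - 1))
   count (wedge (r i) (r i.+1)) [seq (p, q) | p <- S, q <- S] <= _)%N.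
  apply: leq_sum_seq => i; rewrite mem_iota add0n => /andP[_ iX].
  have iX' : (i.+1 < #|` X|)%N by lia.
  by apply: (@wedge_pairs V); rewrite ?rmono ?Xh ?rX // ltnW.
rewrite (exchange_count _ _ (fun i => wedge (r i) (r i.+1))).
have -> : (#|` S| ^ 2 = size [seq (p, q) | p <- S, q <- S] * 1)%N.
  by rewrite size_allpairs muln1 mulnn.
apply: sum_seq_le_const => -[p q] _.
have disj i j : (i < j)%N -> (j < #|` X| - 1)%N ->
    wedge (r i) (r i.+1) (p, q) -> wedge (r j) (r j.+1) (p, q) -> False.
  move=> ij jX; rewrite /wedge /= => /andP[_ h1] /andP[h2 _].
  have le : r i.+1 <= r j.
    have [->//|ne] := eqVneq i.+1 j.
    by apply/ltW/rmono; lia.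
  have : 0 < (r i.+1 - r j) * p ^+ 2.
    have -> : (r i.+1 - r j) * p ^+ 2 = (r i.+1 * p - q) * p + (q - r j * p) * p by ring.
    exact: addr_gt0.
  by rewrite ltNge mulr_le0_ge0 ?subr_le0 ?sqr_ge0.
apply: leq_trans (_ : count predT [:: tt] <= 1)%N => //.
apply: (@count_le_inj _ _ _ _ _ _ (fun=> tt)); rewrite ?iota_uniq // => i j.
rewrite !inE !mem_iota !add0n => /andP[/andP[_ iX] wi] /andP[/andP[_ jX] wj] _.
by case: (ltngtP i j) => // ij; [case: (disj i j)|case: (disj j i)].
Qed.

(** Splitting [U] by sign provides the equal signs that [rich_slopes_half] asks for; each slope
    keeps at least half of its representations in one of the two parts. *)
Lemma rich_slopes (X : {fset R}) (t : nat) :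
  0 \notin U ->
  (forall r, r \in X -> t <= count (fun u => (r * u)%R \in U) U)%N ->
  (#|` X| * t ^ 2 <= 16 * #|` S| ^ 2)%N.
Proof.
move=> U0 Xt; have [->|/fset0Pn[r0 r0X]] := eqVneq X fset0; first by rewrite cardfs0.
have tU : (t <= #|` U|)%N by apply: leq_trans (Xt _ r0X) (count_size _ _).
have US : (#|` U| <= #|` S|)%N.
  have [->|/fset0Pn[u0 u0U]] := eqVneq U fset0; first by rewrite cardfs0.
  rewrite -!count_predT; apply: (@count_le_inj _ _ _ _ _ _ (fun u => u0 + u)).
  - exact: fset_uniq.
  - by move=> x y _ _ /addrI.
  - by move=> x xU _; rewrite addUS.
pose Up := [fset u in U | 0 < u]; pose Un := [fset u in U | u < 0].
pose h := uphalf t.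
have th : (t <= 2 * h)%N by rewrite /h; lia.
have ht : (h <= t)%N by rewrite /h; lia.
pose Xp := [fset r in X | (h <= count (fun u => (r * u)%R \in U) Up)%N].
pose Xn := [fset r in X | (h <= count (fun u => (r * u)%R \in U) Un)%N].
have countU (P : pred R) : (count P U <= count P Up + count P Un)%N.
  rewrite -!size_filter -size_cat; apply: uniq_leq_size; first by rewrite filter_uniq ?fset_uniq.
  move=> u; rewrite mem_cat !mem_filter !inE /= => /andP[-> uU]; rewrite uU /=.
  by case: (ltgtP u 0) => // u0; rewrite -u0 uU in U0.
have XX : (#|` X| <= #|` Xp| + #|` Xn|)%N.
  rewrite -size_cat; apply: uniq_leq_size; first exact: fset_uniq.
  move=> r rX; rewrite mem_cat !inE rX /=.
  have := Xt _ rX; have := countU (fun u => (r * u)%R \in U).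
  move: (count _ U) (count _ Up) (count _ Un) => a b c ab ta.
  by case: (leqP h b) => //= hb; lia.
have hp : ((#|` Xp| - 1) * h ^ 2 <= #|` S| ^ 2)%N.
  apply: (@rich_slopes_half Up) => [u|u v|r]; rewrite !inE /=.
  - by case/andP.
  - by move=> /andP[_ u0] /andP[_ v0]; rewrite mulr_gt0.
  - by case/andP.
have hn : ((#|` Xn| - 1) * h ^ 2 <= #|` S| ^ 2)%N.
  apply: (@rich_slopes_half Un) => [u|u v|r]; rewrite !inE /=.
  - by case/andP.
  - by move=> /andP[_ u0] /andP[_ v0]; rewrite nmulr_rgt0.
  - by case/andP.
(* This pays for the slope lost in each [- 1]: either part satisfies [|X'| h ^ 2 <= 2 |S| ^ 2], and
   [t ^ 2 <= 4 h ^ 2] brings the total to [16 |S| ^ 2]. *)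
have hS : (h ^ 2 <= #|` S| ^ 2)%N by rewrite leq_exp2r //; lia.
have t2 : (t ^ 2 <= 4 * h ^ 2)%N by nia.
move: hp hn hS t2 XX; move: (h ^ 2)%N (t ^ 2)%N (#|` S| ^ 2)%N => H T SS.
by move: #|` X| #|` Xp| #|` Xn| => a b c; nia.
Qed.

End Solymosi.

(** * Energies *)

Lemma perm_fset_filter (T : choiceType) (X : {fset T}) (s : seq T) (P : pred T) :
  uniq s -> (forall x, (x \in X) = (x \in s) && P x) -> perm_eq X (filter P s).
Proof.
move=> us XP; apply: uniq_perm; rewrite ?fset_uniq ?filter_uniq // => x.
by rewrite mem_filter XP andbC.
Qed.

Lemma card_fset_filter (T : choiceType) (X : {fset T}) (s : seq T) (P : pred T) :
  uniq s -> (forall x, (x \in X) = (x \in s) && P x) -> #|` X| = count P s.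
Proof. by move=> us XP; rewrite -size_filter; apply/perm_size/perm_fset_filter. Qed.

(** Write [i ^ 2] as the sum of [2 j - 1] over [1 <= j <= i]: the layers up to [k] contribute at
    most [k i], the others at most [2 j] each. *)
Lemma sqr_le_layers (k n i : nat) : (i <= n)%N ->
  (i ^ 2 <= k * i + \sum_(k.+1 <= j < n.+1) 2 * j * (j <= i))%N.
Proof.
suff H : (minn i n ^ 2 <= k * i + \sum_(k.+1 <= j < n.+1) 2 * j * (j <= i))%N.
  by move=> /minn_idPl e; rewrite e in H.
elim: n => [|n IH]; first by rewrite minn0.
have [kn|nk] := leqP k n; last first.
  by rewrite big_geq // addn0; nia.
rewrite big_nat_recr //=; case: (boolP (n.+1 <= i)%N) => ni.
  have e : minn i n = n by lia.
  have -> : minn i n.+1 = n.+1 by lia.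
  by rewrite e in IH; lia.
have e : minn i n = i by lia.
have -> : minn i n.+1 = i by lia.
by rewrite e in IH; lia.
Qed.

(** Telescoping from [1 / j ^ 2 <= 1 / (j - 1) - 1 / j]. *)
Lemma sum_inv_sqr_le (R : realFieldType) (k n : nat) : (0 < k)%N ->
  \sum_(k.+1 <= j < n.+1) (j%:R ^+ 2)^-1 <= k%:R^-1 :> R.
Proof.
move=> k0; have [nk|kn] := leqP n k; first by rewrite big_geq ?invr_ge0.
suff H : \sum_(k.+1 <= j < n.+1) (j%:R ^+ 2)^-1 <= k%:R^-1 - n%:R^-1 :> R.
  by apply: le_trans H _; rewrite gerBl invr_ge0.
have : (k <= n)%N by apply: ltnW.
elim: n {kn} => [|n IH]; first by rewrite leqn0 => /eqP->; rewrite big_geq ?subrr.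
rewrite leq_eqVlt => /orP[/eqP<-|]; first by rewrite big_geq ?subrr.
rewrite ltnS => kn; rewrite big_nat_recr //=.
apply: le_trans (lerD (IH kn) (lexx _)) _.
have n0 : 0 < n%:R :> R by rewrite ltr0n (leq_trans k0).
have n1 : 0 < n.+1%:R :> R by rewrite ltr0n.
rewrite -addrA lerD2l -subr_ge0.
have -> : - n.+1%:R^-1 - (- n%:R^-1 + (n.+1%:R ^+ 2)^-1) = (n%:R * n.+1%:R ^+ 2)^-1 :> R.
  by rewrite -natr1; field; rewrite natr1 !gt_eqF.
by rewrite invr_ge0 mulr_ge0 ?sqr_ge0 // ltW.
Qed.

Section Energy.
Variables (R : rcfType) (A : {fset R}).
Local Notation n := #|` A|.

Definition incidence (r c : R) : nat := count (fun b => r * b + c \in A) A.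

(** This counts the solutions of [r (b + b') = c + c'] in [A], arranged as incidences of the grid
    [A x A] with lines of slope [r]. *)
Definition energy (r : R) : nat := \sum_(b <- A) \sum_(c <- A) incidence r (r * b - c).

Lemma incidence_le r c : (incidence r c <= n)%N.
Proof. exact: count_size. Qed.

Lemma sum_incidence_le (r : R) (K : {fset R}) : (\sum_(c <- K) incidence r c <= n ^ 2)%N.
Proof.
rewrite /incidence (exchange_count K A (fun c b => r * b + c \in A)) -mulnn.
apply: sum_seq_le_const => b _; rewrite -count_predT.
apply: (@count_le_inj _ _ _ _ _ _ (fun c => r * b + c)); first exact: fset_uniq.
  by move=> c c' _ _ /addrI.
by move=> c _ ->.
Qed.

(** Up to richness [k], each slope costs at most [k n ^ 2], since a grid point lies on one line of
    that slope. Above it, [rich_lines] leaves [180 n ^ 4 / j ^ 3] lines at level [j], with weight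
    [2 j], and the tail of [1 / j ^ 2] is at most [1 / k]. *)
Lemma sum_sqr_incidence (X K : {fset R}) (k : nat) : 0 \notin X -> (0 < k)%N ->
  (\sum_(r <- X) \sum_(c <- K) incidence r c ^ 2)%:R <=
  k%:R * #|` X|%:R * n%:R ^+ 2 + 360 * n%:R ^+ 4 / k%:R :> R.
Proof.
move=> X0 k0; pose ll := [seq (r, c) | r <- X, c <- K].
have ull : uniq ll by apply: allpairs_uniq; rewrite ?fset_uniq // => -[? ?] [? ?].
pose L j := [fset l in ll | (j <= incidence l.1 l.2)%N].
have LE j l : (l \in L j) = (l \in ll) && (j <= incidence l.1 l.2)%N by rewrite !inE.
have Lj j : (1 < j)%N -> (#|` L j| * j ^ 3 <= 180 * (n ^ 2 * n ^ 2))%N.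
  move=> j1; apply: rich_lines => // l; rewrite LE => /andP[/allpairsP[[r c] [/= rX _ ->]]].
  by move=> ?; split=> //; apply: contraNneq X0 => <-.
have le1 : (\sum_(r <- X) \sum_(c <- K) incidence r c ^ 2 <=
    k * (#|` X| * n ^ 2) + \sum_(k.+1 <= j < n.+1) 2 * j * #|` L j|)%N.
  have -> : (\sum_(r <- X) \sum_(c <- K) incidence r c ^ 2 =
      \sum_(l <- ll) incidence l.1 l.2 ^ 2)%N by rewrite big_allpairs.
  apply: leq_trans (_ : \sum_(l <- ll) (k * incidence l.1 l.2 +
     \sum_(k.+1 <= j < n.+1) 2 * j * (j <= incidence l.1 l.2)) <= _)%N.
    by apply: leq_sum => l _; apply: sqr_le_layers; apply: incidence_le.
  rewrite big_split /= leq_add //.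
    rewrite -big_distrr leq_mul2l /=; apply/orP; right.
    rewrite big_allpairs; apply: sum_seq_le_const => r _; exact: sum_incidence_le.
  rewrite exchange_big; apply: leq_sum => j _ /=; rewrite -big_distrr leq_mul2l /=.
  apply/orP; right; rewrite (card_fset_filter ull (LE j)) -sum1_count [leqRHS]big_mkcond.
  by apply: leq_sum => l _; case: ifP.
apply: le_trans (_ : (k * (#|` X| * n ^ 2) +
   \sum_(k.+1 <= j < n.+1) 2 * j * #|` L j|)%:R <= _); first by rewrite ler_nat.
rewrite natrD; apply: lerD; first by rewrite natrM natrM natrX mulrA.
rewrite natr_sum.
apply: le_trans (_ : \sum_(k.+1 <= j < n.+1) 360 * n%:R ^+ 4 * (j%:R ^+ 2)^-1 <= _).
  rewrite big_nat [leRHS]big_nat; apply: ler_sum => j /andP[kj _].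
  have j1 : (1 < j)%N by apply: leq_ltn_trans kj.
  have j0 : 0 < j%:R :> R by rewrite ltr0n; lia.
  rewrite -(ler_pM2r (_ : 0 < j%:R ^+ 2)) ?exprn_gt0 // mulfVK ?gt_eqF ?exprn_gt0 //.
  have := Lj _ j1; rewrite -(ler_nat R) => H.
  have -> : (2 * j * #|` L j|)%:R * j%:R ^+ 2 = 2 * (#|` L j| * j ^ 3)%:R :> R.
    by rewrite 3!natrM natrX; ring.
  have -> : 360 * n%:R ^+ 4 = 2 * (180 * (n ^ 2 * n ^ 2))%:R :> R.
    by rewrite 2!natrM !natrX; ring.
  by rewrite ler_pM2l.
rewrite -big_distrr ler_wpM2l ?sum_inv_sqr_le //.
by rewrite mulr_ge0 ?exprn_ge0.
Qed.

(** The pairs with [r b - c = x] are the grid points on the line of slope [r] and intercept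
    [- x]. *)
Lemma sum_over_differences (r : R) (K : {fset R}) (F : R -> nat) :
  (forall b c, b \in A -> c \in A -> r * b - c \in K) ->
  (\sum_(b <- A) \sum_(c <- A) F (r * b - c)%R = \sum_(x <- K) incidence r (- x)%R * F x)%N.
Proof.
move=> AK.
transitivity (\sum_(b <- A) \sum_(x <- K) ((r * b - x)%R \in A) * F x)%N.
  apply: eq_big_seq => b bA.
  transitivity (\sum_(c <- A) \sum_(x <- K) (x == r * b - c)%R * F x)%N.
    apply: eq_big_seq => c cA; rewrite (bigD1_seq (r * b - c)) ?fset_uniq ?AK //= eqxx mul1n.
    by rewrite big1 ?addn0 // => x /negPf->.
  rewrite exchange_big; apply: eq_bigr => x _ /=; rewrite -big_distrl /=; congr muln.
  rewrite -(count_uniq_mem _ (fset_uniq A)) -sum1_count [RHS]big_mkcond.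
  apply: eq_bigr => c _ /=; rewrite (_ : (x == _) = (c == r * b - x)); first by case: eqP.
  by apply/eqP/eqP => ->; ring.
rewrite exchange_big; apply: eq_bigr => x _ /=; rewrite -big_distrl /=; congr muln.
by rewrite /incidence -sum1_count [RHS]big_mkcond; apply: eq_bigr => b _; case: ifP.
Qed.

(** Grouped by difference, the energy is a sum of products of the incidences at [x] and [- x]. By
    [2 i j <= i ^ 2 + j ^ 2] it reduces to two sums of squares, over [K] and its reflection [K']. *)
Lemma energy_threshold (X : {fset R}) (k : nat) : 0 \notin X -> (0 < k)%N ->
  (\sum_(r <- X) energy r)%:R <=
  k%:R * #|` X|%:R * n%:R ^+ 2 + 360 * n%:R ^+ 4 / k%:R :> R.
Proof.
move=> X0 k0.
pose K := [fset x in [seq r * p.1 - p.2 | r <- X, p <- [seq (b, c) | b <- A, c <- A]]].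
pose K' := [fset - x | x in K].
have AK r b c : r \in X -> b \in A -> c \in A -> r * b - c \in K.
  move=> rX bA cA; rewrite !inE /=; apply/allpairsP; exists (r, (b, c)) => /=.
  by rewrite rX allpairs_f.
have E r : r \in X -> (2 * energy r <=
    \sum_(x <- K) incidence r x ^ 2 + \sum_(x <- K') incidence r x ^ 2)%N.
  move=> rX; rewrite /energy (@sum_over_differences r K) => [|b c bA cA]; last exact: AK.
  have -> : (\sum_(x <- K') incidence r x ^ 2 = \sum_(x <- K) incidence r (- x)%R ^ 2)%N.
    by rewrite big_imfset /=; last by move=> x y _ _; apply: oppr_inj.
  rewrite -big_split big_distrr /=; apply: leq_sum => x _.
  move: (incidence r x) (incidence r (- x)) => i j.
  by rewrite [(j * i)%N]mulnC; case: (nat_Cauchy i j).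
have H1 := sum_sqr_incidence K X0 k0; have H2 := sum_sqr_incidence K' X0 k0.
suff : (2 * \sum_(r <- X) energy r <= \sum_(r <- X) \sum_(c <- K) incidence r c ^ 2 +
   \sum_(r <- X) \sum_(c <- K') incidence r c ^ 2)%N.
  by rewrite -(ler_nat R) natrM natrD; lra.
by rewrite -big_split big_distrr /=; apply: leq_sum_seq.
Qed.

(** The least [k] with [n ^ 2 <= k ^ 2 |X|] balances [energy_threshold]: it satisfies
    [n <= k sqrt |X| <= 2 n], where [|X| <= n ^ 2] settles the case [k = 1]. The two terms
    contribute 2 and 360. *)
Lemma energy_bound (X : {fset R}) : 0 \notin X -> (#|` X| <= n ^ 2)%N ->
  (\sum_(r <- X) energy r)%:R <= 362 * n%:R ^+ 3 * Num.sqrt #|` X|%:R :> R.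
Proof.
move=> X0 Xn; have [->|XN0] := eqVneq X fset0.
  by rewrite big_seq_fset0 cardfs0 sqrtr0 mulr0.
have x0 : (0 < #|` X|)%N by rewrite cardfs_gt0.
have ex : exists k, (n ^ 2 <= k ^ 2 * #|` X|)%N.
  by exists n; rewrite leq_pmulr.
case: (ex_minnP ex) => k kX kmin.
have n0 : (0 < n)%N by move: Xn x0; case: (n) => //; lia.
have k0 : (0 < k)%N by nia.
have kX' : (k ^ 2 * #|` X| <= 4 * n ^ 2)%N.
  have [k1|k1] := leqP k 1.
    have -> : k = 1%N by lia.
    by rewrite exp1n mul1n; lia.
  have lt : (k.-1 ^ 2 * #|` X| < n ^ 2)%N.
    by rewrite ltnNge; apply/negP => /kmin; lia.
  have le : (k ^ 2 <= 4 * k.-1 ^ 2)%N by nia.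
  have := leq_mul le (leqnn #|` X|); rewrite -mulnA; lia.
apply: le_trans (energy_threshold X0 k0) _.
set s := Num.sqrt _.
have s0 : 0 < s by rewrite sqrtr_gt0 ltr0n.
have ss : #|` X|%:R = s ^+ 2 :> R by rewrite sqr_sqrtr.
have kr : 0 < k%:R :> R by rewrite ltr0n.
have nr : 0 < n%:R :> R by rewrite ltr0n.
move: kX kX'; rewrite -!(ler_nat R) !(natrX, natrM) ss -exprMn => h1 h2.
have {}h1 : n%:R <= k%:R * s by rewrite -(@ler_pXn2r _ 2) ?nnegrE ?mulr_ge0 // ltW.
have {}h2 : k%:R * s <= 2 * n%:R.
  rewrite -(@ler_pXn2r _ 2) ?nnegrE ?mulr_ge0 //; try exact: ltW.
  by rewrite [leRHS]exprMn -natrX.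
have t1 : k%:R * s ^+ 2 * n%:R ^+ 2 <= 2 * n%:R ^+ 3 * s.
  have -> : k%:R * s ^+ 2 * n%:R ^+ 2 = (k%:R * s) * (s * n%:R ^+ 2) by ring.
  have -> : 2 * n%:R ^+ 3 * s = 2 * n%:R * (s * n%:R ^+ 2) by ring.
  by rewrite ler_wpM2r // mulr_ge0 ?sqr_ge0 // ltW.
have t2 : 360 * n%:R ^+ 4 / k%:R <= 360 * n%:R ^+ 3 * s.
  rewrite ler_pdivrMr //.
  have -> : 360 * n%:R ^+ 3 * s * k%:R = 360 * n%:R ^+ 3 * (k%:R * s) by ring.
  have -> : 360 * n%:R ^+ 4 = 360 * n%:R ^+ 3 * n%:R :> R by ring.
  by rewrite ler_wpM2l // mulr_ge0 // exprn_ge0.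
lra.
Qed.

End Energy.

(** * Quotients *)

(** Cauchy-Schwarz for the fibre sizes [m p], by summing [2 m p m q <= m p ^ 2 + m q ^ 2] over all
    pairs. *)
Lemma collision_lower_bound (T : eqType) (T' : choiceType) (Z : seq T) (P : {fset T'})
    (f : T -> T') :
  (forall z, z \in Z -> f z \in P) ->
  (size Z ^ 2 <= #|` P| * \sum_(z <- Z) count (fun z' => f z == f z') Z)%N.
Proof.
move=> fP; pose m p := count (fun z => f z == p) Z.
have sum_P (F : T' -> nat) z : z \in Z -> (\sum_(p <- P) (f z == p) * F p = F (f z))%N.
  move=> /fP zP; rewrite (bigD1_seq (f z)) ?fset_uniq //= eqxx mul1n big1 ?addn0 // => p.
  by rewrite eq_sym => /negPf->.
have sum_Z (F : T' -> nat) : (\sum_(z <- Z) F (f z) = \sum_(p <- P) m p * F p)%N.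
  rewrite -(eq_big_seq _ (sum_P F)) exchange_big; apply: eq_bigr => p _ /=.
  rewrite -big_distrl /=; congr muln.
  by rewrite /m -sum1_count [RHS]big_mkcond; apply: eq_bigr => z _; case: eqP.
have -> : size Z = (\sum_(p <- P) m p)%N.
  have := sum_Z (fun=> 1%N); rewrite sum1_size => ->.
  by apply: eq_bigr => p _; rewrite muln1.
have -> : (\sum_(z <- Z) count (fun z' => f z == f z') Z = \sum_(p <- P) m p * m p)%N.
  rewrite -(sum_Z m); apply: eq_bigr => z _; apply: eq_count => z' /=.
  exact: eq_sym.
rewrite -(leq_pmul2l (isT : 0 < 2)%N) -mulnn big_distrlr /= big_distrr /=.
under eq_bigr do rewrite big_distrr /=.
apply: leq_trans (_ : \sum_(p <- P) \sum_(q <- P) (m p * m p + m q * m q) <= _)%N.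
  apply: leq_sum => p _; apply: leq_sum => q _.
  by rewrite !mulnn; case: (nat_Cauchy (m p) (m q)).
have cst (c : nat) : (\sum_(p <- P) c = #|` P| * c)%N.
  by rewrite big_const_seq count_predT iter_addn_0 mulnC.
under eq_bigr do rewrite big_split /= cst.
rewrite big_split /= cst -big_distrr /= addnn -mul2n; exact: leqnn.
Qed.

Lemma sum_bool_count (T : Type) (s : seq T) (P : pred T) : (\sum_(x <- s) P x = count P s)%N.
Proof. by rewrite -sum1_count [RHS]big_mkcond; apply: eq_bigr => x _; case: (P x). Qed.

Section Quotients.
Variables (R : rcfType) (A U : {fset R}).
Hypothesis U0 : 0 \notin U.
Local Notation n := #|` A|.

Definition multiplicity (r : R) : nat := count (fun u => r * u \in U) U.

Definition quotients : {fset R} := [fset x in [seq v / u | v <- U, u <- U]].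

Definition rich_quotients (t : nat) : {fset R} :=
  [fset r in quotients | (t <= multiplicity r)%N].

Lemma in_rich_quotients t r :
  (r \in rich_quotients t) = (r \in quotients) && (t <= multiplicity r)%N.
Proof. by rewrite !inE. Qed.

Lemma neq0U u : u \in U -> u != 0.
Proof. by move=> uU; apply: contraNneq U0 => <-. Qed.

Lemma sum_over_quotients (F : R -> nat) :
  (\sum_(u <- U) \sum_(v <- U) F (v / u)%R = \sum_(r <- quotients) multiplicity r * F r)%N.
Proof.
transitivity (\sum_(u <- U) \sum_(r <- quotients) ((r * u)%R \in U) * F r)%N.
  apply: eq_big_seq => u uU.
  transitivity (\sum_(v <- U) \sum_(r <- quotients) (r == v / u)%R * F r)%N.
    apply: eq_big_seq => v vU; rewrite (bigD1_seq (v / u)) ?fset_uniq //=; last first.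
      by rewrite !inE /=; apply/allpairsP; exists (v, u); rewrite /= vU uU.
    by rewrite eqxx mul1n big1 ?addn0 // => r /negPf->.
  rewrite exchange_big; apply: eq_bigr => r _ /=; rewrite -big_distrl /=; congr muln.
  rewrite -(count_uniq_mem _ (fset_uniq U)) sum_bool_count; apply: eq_count => v /=.
  by apply/eqP/eqP => ->; rewrite ?mulfVK ?mulfK ?neq0U.
rewrite exchange_big; apply: eq_bigr => r _ /=; rewrite -big_distrl /=; congr muln.
by rewrite sum_bool_count.
Qed.

Lemma rich_quotients_neq0 t : 0 \notin rich_quotients t.
Proof.
apply/negP; rewrite !inE => /andP[/allpairsP[[v u] [/= /neq0U v0 /neq0U u0]]] /esym/eqP.
by rewrite mulf_eq0 invr_eq0 (negPf v0) (negPf u0).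
Qed.

(** Markov's inequality, as all multiplicities add up to [|U| ^ 2]. *)
Lemma card_rich_quotients t : (#|` rich_quotients t| * t <= #|` U| ^ 2)%N.
Proof.
have <- : (\sum_(r <- quotients) multiplicity r = #|` U| ^ 2)%N.
  have := sum_over_quotients (fun=> 1%N).
  under [X in _ = X]eq_bigr do rewrite muln1.
  by move=> <-; rewrite -mulnn; under eq_bigr do rewrite sum1_size;
     rewrite big_const_seq count_predT iter_addn_0.
rewrite (card_fset_filter (fset_uniq _) (in_rich_quotients t)) -sum_bool_count big_distrl /=.
by apply: leq_sum => r _; case: (boolP (t <= _)%N) => [h|_]; rewrite ?mul1n ?mul0n.
Qed.

(** A multiplicity is the number of thresholds [t >= 1] that it reaches; none exceeds [|U|], so
    stopping at [N] loses nothing. *)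
Lemma sum_over_rich_quotients (N : nat) (F : R -> nat) : (#|` U| <= N)%N ->
  (\sum_(r <- quotients) multiplicity r * F r =
   \sum_(1 <= t < N.+1) \sum_(r <- rich_quotients t) F r)%N.
Proof.
move=> UN.
transitivity (\sum_(r <- quotients) \sum_(1 <= t < N.+1) (t <= multiplicity r)%N * F r)%N.
  apply: eq_bigr => r _; rewrite -big_distrl /=; congr muln.
  have : (multiplicity r <= N)%N by apply: leq_trans UN; apply: count_size.
  move: (multiplicity r) => m mN.
  rewrite (big_cat_nat (n := m.+1)) //= -[LHS]addn0; congr addn.
    rewrite (eq_big_nat _ _ (F2 := fun=> 1%N)); last by move=> t /andP[_]; rewrite ltnS => ->.
    by rewrite sum_nat_const_nat; lia.
  by rewrite big_nat big1 // => t; case: leqP => //; lia.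
rewrite exchange_big; apply: eq_bigr => t _ /=.
rewrite (perm_big _ (perm_fset_filter (fset_uniq _) (in_rich_quotients t))).
rewrite big_filter [RHS]big_mkcond.
by apply: eq_bigr => r _; case: ifP; rewrite ?mul1n ?mul0n.
Qed.

(** Cauchy-Schwarz for the products [u (b + c)]: a coincidence [u (c' + b') = v (c + b)] is a
    solution counted by the energy of [v / u]. The coincidences are then layered by the multiplicity
    of the quotient. *)
Lemma sum_energy_lower_bound (P : {fset R}) : (#|` U| <= n)%N ->
  (forall u b c, u \in U -> b \in A -> c \in A -> u * (b + c) \in P) ->
  ((#|` U| * n ^ 2) ^ 2 <=
   #|` P| * \sum_(1 <= t < n.+1) \sum_(r <- rich_quotients t) energy A r)%N.
Proof.
move=> Un UAP; pose W := [seq (c, b) | c <- A, b <- A].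
pose Z := [seq (u, w) | u <- U, w <- W].
pose f (z : R * (R * R)) := z.1 * (z.2.1 + z.2.2).
have fZ z : z \in Z -> f z \in P.
  by move=> /allpairsP[[u w] [/= uU /allpairsP[[c b] [/= cA bA ->]] ->]]; apply: UAP.
have := collision_lower_bound fZ; rewrite !size_allpairs mulnn.
suff -> : (\sum_(z <- Z) count (fun z' => f z == f z') Z =
    \sum_(1 <= t < n.+1) \sum_(r <- rich_quotients t) energy A r)%N by [].
rewrite -(sum_over_rich_quotients _ Un) -sum_over_quotients big_allpairs.
apply: eq_big_seq => u uU.
transitivity (\sum_(w <- W) \sum_(v <- U)
    count (fun w' => u * (w.1 + w.2) == v * (w'.1 + w'.2))%R W)%N.
  apply: eq_bigr => w _.
  by rewrite -(count_pairs U W (fun v w' => u * (w.1 + w.2) == v * (w'.1 + w'.2))).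
rewrite exchange_big; apply: eq_bigr => v _ /=.
(* The swap makes [c + b], the sum that [v / u] multiplies, the outer pair. *)
rewrite (exchange_count W W (fun w w' => u * (w.1 + w.2) == v * (w'.1 + w'.2))).
rewrite big_allpairs; apply: eq_bigr => c _ /=.
transitivity (\sum_(b <- A) \sum_(c' <- A) ((v / u * b + (v / u * c - c'))%R \in A))%N.
  apply: eq_bigr => b _.
  rewrite (count_pairs A A (fun c' b' => u * (c' + b') == v * (c + b))).
  apply: eq_bigr => c' _; rewrite -(count_uniq_mem _ (fset_uniq A)); apply: eq_count => b' /=.
  have u0 := neq0U uU.
  rewrite -(inj_eq (mulfI u0) b').
  have -> : u * (v / u * b + (v / u * c - c')) = v * (c + b) - u * c' by field.
  by apply/eqP/eqP => e; [rewrite -e; ring | rewrite mulrDr e; ring].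
by rewrite exchange_big; apply: eq_bigr => c' _ /=; rewrite sum_bool_count.
Qed.

(** The line [u -> s (r u + d)] meets the grid [U x Q] whenever [r u] is in [U], hence at least [t]
    times. Different pairs give different lines: the intercept [s d] recovers [s] because [d != 0],
    and the slope then recovers [r]. *)
Lemma rich_quotients_translate (S Q : {fset R}) (d : R) (t : nat) : d != 0 -> (1 < t)%N ->
  0 \notin S -> (forall u s, u \in U -> s \in S -> s * (u + d) \in Q) ->
  (#|` rich_quotients t| * #|` S| * t ^ 3 <= 180 * (#|` U| ^ 2 * #|` Q| ^ 2))%N.
Proof.
move=> d0 t1 S0 SQ; pose ll := [seq (r * s, s * d) | r <- rich_quotients t, s <- S].
have s0 s : s \in S -> s != 0 by move=> sS; apply: contraNneq S0 => <-.
have ull : uniq ll.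
  apply: allpairs_uniq; rewrite ?fset_uniq // => -[r s] [r' s'].
  move=> /allpairsP[[? ?] [/= _ sS [-> ->]]] /allpairsP[[? ?] [/= _ sS' [-> ->]]].
  move=> [e1 /(mulIf d0) e2].
  by move: e1; rewrite e2 => /mulIf ->; rewrite ?s0.
pose L := [fset l in ll].
have LE l : (l \in L) = (l \in ll) && predT l by rewrite !inE andbT.
have -> : (#|` rich_quotients t| * #|` S| = #|` L|)%N.
  by rewrite (card_fset_filter ull LE) count_predT size_allpairs.
apply: rich_lines => // l; rewrite LE => /andP[/allpairsP[[r s] [/= rX sS ->]] _] /=.
have r0 : r != 0 by apply: contraNneq (rich_quotients_neq0 t) => <-.
split; first by rewrite mulf_neq0 // s0.
move: rX; rewrite in_rich_quotients => /andP[_ tr]; apply: leq_trans tr _.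
apply: sub_count => u /= ru; have -> : r * s * u + s * d = s * (r * u + d) by ring.
exact: SQ.
Qed.

End Quotients.

(** * Assembling the bounds *)

Section Sums.
Variable R : realType.
Local Notation sqrt := (@Num.sqrt R).

(** With [a], [b] consecutive square roots, the induction step [2 a + 1 / b <= 2 b] amounts to
    [(b - a) ^ 2 >= 0]. *)
Lemma sum_inv_sqrt_le (T : nat) : \sum_(1 <= t < T.+1) (sqrt t%:R)^-1 <= 2 * sqrt T%:R.
Proof.
elim: T => [|T IH]; first by rewrite big_geq // sqrtr0 mulr0.
rewrite big_nat_recr //=; apply: le_trans (lerD IH (lexx _)) _.
have b0 : 0 < sqrt T.+1%:R by rewrite sqrtr_gt0.
have a0 : 0 <= sqrt T%:R by rewrite sqrtr_ge0.
have ea : sqrt T%:R ^+ 2 = T%:R by rewrite sqr_sqrtr.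
have eb : sqrt T.+1%:R ^+ 2 = T%:R + 1 by rewrite sqr_sqrtr // natr1.
move: (sqrt T%:R) (sqrt T.+1%:R) ea eb a0 b0 => a b ea eb a0 b0.
rewrite -(ler_pM2r b0) mulrDl mulVf ?gt_eqF //.
have := sqr_ge0 (b - a); nra.
Qed.

Lemma sum_inv_sqrt3_le (T n : nat) : (0 < T)%N ->
  \sum_(T.+1 <= t < n.+1) (t%:R * sqrt t%:R)^-1 <= 2 / sqrt T%:R.
Proof.
move=> T0; have [nT|Tn] := leqP n T.
  by rewrite big_geq // divr_ge0 ?sqrtr_ge0.
suff H : \sum_(T.+1 <= t < n.+1) (t%:R * sqrt t%:R)^-1 <= 2 / sqrt T%:R - 2 / sqrt n%:R.
  by apply: le_trans H _; rewrite gerBl divr_ge0 ?sqrtr_ge0.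
have : (T <= n)%N by apply: ltnW.
elim: n {Tn} => [|n IH]; first by rewrite leqn0 => /eqP->; rewrite big_geq ?subrr.
rewrite leq_eqVlt => /orP[/eqP<-|]; first by rewrite big_geq ?subrr.
rewrite ltnS => Tn; rewrite big_nat_recr //=.
apply: le_trans (lerD (IH Tn) (lexx _)) _.
have b0 : 0 < sqrt n.+1%:R by rewrite sqrtr_gt0.
have a0 : 0 < sqrt n%:R by rewrite sqrtr_gt0 ltr0n (leq_trans T0).
have ea : sqrt n%:R ^+ 2 = n%:R by rewrite sqr_sqrtr.
have eb : sqrt n.+1%:R ^+ 2 = n%:R + 1 by rewrite sqr_sqrtr // natr1.
have -> : n.+1%:R * sqrt n.+1%:R = sqrt n.+1%:R ^+ 2 * sqrt n.+1%:R.
  by rewrite sqr_sqrtr.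
move: (sqrt n%:R) (sqrt n.+1%:R) ea eb a0 b0 => a b ea eb a0 b0.
rewrite -addrA lerD2l -subr_ge0.
have -> : - (2 / b) - (- (2 / a) + (b ^+ 2 * b)^-1) =
   (2 * b ^+ 2 * (b - a) - a) / (a * b ^+ 3) by field; rewrite !gt_eqF.
rewrite divr_ge0 ?mulr_ge0 ?exprn_ge0 ?(ltW a0) ?(ltW b0) //.
have ab : a < b by rewrite -(@ltr_pXn2r _ 2) ?nnegrE ?(ltW a0) ?(ltW b0) // ea eb ltrDl.
(* The numerator is nonnegative: [a < b] gives [2 b (b - a) >= 1], hence
   [2 b ^ 2 (b - a) >= b > a]. *)
have e1 : (b - a) * (b + a) = 1 by rewrite -subr_sqr ea eb; ring.
have h : 1 <= 2 * b * (b - a) by nra.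
have : b <= 2 * b ^+ 2 * (b - a).
  by rewrite (_ : 2 * b ^+ 2 * (b - a) = 2 * b * (b - a) * b) ?ler_peMl ?(ltW b0) //; ring.
lra.
Qed.

Lemma ln2_le1 : ln 2 <= 1 :> R.
Proof. by have := @le_ln1Dx R 1; rewrite -[1 + 1]/2; apply; lra. Qed.

(** The sum is at most [1 + ln n], and for [n >= 2] both [1] and [ln n] are at most [log2 n]. *)
Lemma sum_inv_le (n : nat) : (1 < n)%N -> \sum_(1 <= t < n.+1) t%:R^-1 <= 2 * log2 (n%:R : R).
Proof.
move=> n1; have l2 : 0 < ln 2 :> R by rewrite ln_gt0 ?ltr1n.
have nr : 0 < n%:R :> R by rewrite ltr0n ltnW.
have L1 : 1 <= log2 (n%:R : R).
  by rewrite /log2 ler_pdivlMr // mul1r ler_ln ?posrE // (ler_nat R 2 n).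
have Ln : ln (n%:R : R) <= log2 n%:R.
  rewrite -[leLHS](mulfVK (lt0r_neq0 l2)) -/(log2 _) ler_piMr ?ln2_le1 //.
  by apply: le_trans L1.
suff : \sum_(1 <= t < n.+1) t%:R^-1 <= 1 + ln n%:R :> R by lra.
have : (0 < n)%N by apply: ltnW.
elim: n {n1 nr L1 Ln} => // -[|n] IH _; first by rewrite big_nat1 invr1 ln1 addr0.
rewrite big_nat_recr //=; apply: le_trans (lerD (IH isT) (lexx _)) _.
have n0 : 0 < n.+1%:R :> R by rewrite ltr0n.
have m0 : 0 < n.+2%:R :> R by rewrite ltr0n.
rewrite -addrA lerD2l.
have : ln (1 + - n.+2%:R^-1) <= - n.+2%:R^-1 :> R.
  by apply: le_ln1Dx; rewrite ltrN2 invf_lt1 ?ltr1n.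
have -> : 1 + - n.+2%:R^-1 = n.+1%:R / n.+2%:R :> R.
  rewrite (_ : n.+1%:R = n.+2%:R - 1); last by rewrite -[n.+2%:R]natr1 addrK.
  by rewrite mulrBl divff ?gt_eqF // mul1r.
rewrite ln_div ?posrE //.
by move: (ln n.+1%:R) (ln n.+2%:R) (n.+2%:R^-1) => a b c h; lra.
Qed.

End Sums.

Section RichSums.
Variables (R : realType) (X : nat -> nat) (n : nat).
Local Notation sqrt := (@Num.sqrt R).

Lemma sum_sqrt_le_harmonic (s : R) : 0 <= s ->
  (forall t, (0 < t)%N -> (X t)%:R * t%:R ^+ 2 <= 16 * s ^+ 2) ->
  \sum_(1 <= t < n.+1) sqrt (X t)%:R <= 4 * s * \sum_(1 <= t < n.+1) t%:R^-1.
Proof.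
move=> s0 Xs; rewrite big_distrr /= big_nat [leRHS]big_nat; apply: ler_sum => t /andP[t0 _].
have tr : 0 < t%:R :> R by rewrite ltr0n.
rewrite ler_pdivlMr //.
rewrite -(@ler_pXn2r _ 2) ?nnegrE ?mulr_ge0 ?sqrtr_ge0 //; try exact: ltW.
rewrite exprMn sqr_sqrtr //; apply: le_trans (Xs _ t0) _.
by rewrite exprMn; lra.
Qed.

(** Up to [T] the bound [n ^ 2 / t] is used, beyond [T] the bound [D / t ^ 3]. *)
Lemma sum_sqrt_le_split (D : R) (T : nat) : (0 < T)%N -> 0 <= D ->
  (forall t, (0 < t)%N -> (X t)%:R * t%:R <= n%:R ^+ 2 :> R) ->
  (forall t, (1 < t)%N -> (X t)%:R * t%:R ^+ 3 <= D) ->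
  \sum_(1 <= t < n.+1) sqrt (X t)%:R <= 2 * n%:R * sqrt T%:R + 2 * sqrt D / sqrt T%:R.
Proof.
move=> T0 D0 X1 X3.
have small m : \sum_(1 <= t < m.+1) sqrt (X t)%:R <= 2 * n%:R * sqrt m%:R.
  apply: le_trans (_ : \sum_(1 <= t < m.+1) n%:R * (sqrt t%:R)^-1 <= _).
    rewrite big_nat [leRHS]big_nat; apply: ler_sum => t /andP[t0 _].
    rewrite ler_pdivlMr ?sqrtr_gt0 ?ltr0n // -sqrtrM // -[leRHS]ger0_norm // -sqrtr_sqr.
    by rewrite ler_wsqrtr ?X1.
  rewrite -big_distrr /=; apply: le_trans (ler_wpM2l _ (sum_inv_sqrt_le _ _)) _ => //.
  by rewrite mulrCA mulrA.
have [nT|Tn] := leqP n T.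
  apply: le_trans (small n) _; apply: ler_wpDr; first by rewrite divr_ge0 ?mulr_ge0 ?sqrtr_ge0.
  by rewrite ler_wpM2l ?mulr_ge0 // ler_wsqrtr ?ler_nat.
rewrite (big_cat_nat (n := T.+1)) //=; last by rewrite ltnS ltnW.
apply: lerD; first exact: small.
apply: le_trans (_ : \sum_(T.+1 <= t < n.+1) sqrt D * (t%:R * sqrt t%:R)^-1 <= _).
  rewrite big_nat [leRHS]big_nat; apply: ler_sum => t /andP[Tt _].
  have t1 : (1 < t)%N by apply: leq_ltn_trans Tt.
  have tr : 0 < t%:R :> R by rewrite ltr0n ltnW.
  rewrite ler_pdivlMr ?mulr_gt0 ?sqrtr_gt0 //.
  have -> : t%:R * sqrt t%:R = sqrt (t%:R ^+ 3).
    by rewrite exprSr sqrtrM ?sqr_ge0 // sqrtr_sqr ger0_norm.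
  by rewrite -sqrtrM // ler_wsqrtr ?X3.
rewrite -big_distrr /=; apply: le_trans (ler_wpM2l _ (sum_inv_sqrt3_le _ _ T0)) _ => //.
  exact: sqrtr_ge0.
by rewrite mulrCA mulrA.
Qed.

End RichSums.

(* The truncated optimum [T ~ M / sqrt s] of [sum_sqrt_le_split]. *)
Lemma optimal_split (R : realType) (n M s B : R) : 0 < n -> 1 <= s -> s <= M -> 0 <= B ->
  (forall T : nat, (0 < T)%N -> B <= 2 * n * Num.sqrt T%:R +
     2 * Num.sqrt (360 * n ^+ 2 * M ^+ 2 / s) / Num.sqrt T%:R) ->
  B ^+ 4 * s <= 78 ^+ 4 * n ^+ 4 * M ^+ 2.
Proof.
move=> n0 s1 sM B0 HB; pose v := M / Num.sqrt s; pose w := Num.sqrt v.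
have s0 : 0 < s by lra.
have M0 : 0 < M by lra.
have q0 : 0 < Num.sqrt s by rewrite sqrtr_gt0.
have qq : Num.sqrt s ^+ 2 = s by rewrite sqr_sqrtr ?ltW.
(* From [1 <= s <= M], so the truncation [T] of [v] is positive and [sqrt T] lies within a factor 2
   of [w]. *)
have v1 : 1 <= v by rewrite /v ler_pdivlMr // mul1r; nra.
have v0 : 0 < v by lra.
have w0 : 0 < w by rewrite sqrtr_gt0.
have ww : w ^+ 2 = v by rewrite sqr_sqrtr ?ltW.
have vv : v ^+ 2 = M ^+ 2 / s by rewrite /v expr_div_n qq.
pose T := Num.truncn v.
have /andP[Tv vT] : T%:R <= v < T.+1%:R by apply: truncn_itv; apply: ltW.
have T0 : (0 < T)%N by rewrite truncn_gt_nat.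
have T1 : 1 <= T%:R :> R by rewrite ler1n.
have t0 : 0 < Num.sqrt T%:R :> R by rewrite sqrtr_gt0; lra.
have tt : Num.sqrt T%:R ^+ 2 = T%:R :> R by rewrite sqr_sqrtr.
have tw : Num.sqrt T%:R <= w by apply: ler_wsqrtr.
have wt : w <= 2 * Num.sqrt T%:R.
  rewrite -(@ler_pXn2r _ 2) ?nnegrE ?mulr_ge0 //; try exact: ltW.
  by rewrite exprMn tt ww; rewrite -natr1 in vT; lra.
have D : Num.sqrt (360 * n ^+ 2 * M ^+ 2 / s) <= 19 * n * v.
  have nv : 0 <= 19 * n * v by apply: mulr_ge0; [apply: mulr_ge0 => //|]; exact: ltW.
  rewrite -[leRHS]ger0_norm // -sqrtr_sqr; apply: ler_wsqrtr.
  rewrite -mulrA -vv; have -> : (19 * n * v) ^+ 2 = 361 * n ^+ 2 * v ^+ 2 by ring.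
  by rewrite ler_wpM2r ?sqr_ge0 // ler_wpM2r ?sqr_ge0 //; lra.
(* The first term is at most [2 n w]. In the second, [360 <= 19 ^ 2] and [w <= 2 sqrt T] give
   [76 n w]. *)
have BW : B <= 78 * n * w.
  apply: le_trans (HB _ T0) _.
  have -> : 78 * n * w = 2 * n * w + 76 * n * w by ring.
  apply: lerD; first by rewrite ler_wpM2l // mulr_ge0 // ltW.
  rewrite ler_pdivrMr //.
  apply: le_trans (ler_wpM2l _ D) _ => //.
  have -> : 2 * (19 * n * v) = 38 * n * w * w by rewrite -ww; ring.
  have -> : 76 * n * w * Num.sqrt T%:R = 38 * n * w * (2 * Num.sqrt T%:R) by ring.
  by rewrite ler_wpM2l // !mulr_ge0 // ltW.
have -> : 78 ^+ 4 * n ^+ 4 * M ^+ 2 = (78 * n * w) ^+ 4 * s.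
  have -> : (78 * n * w) ^+ 4 = 78 ^+ 4 * n ^+ 4 * (w ^+ 2) ^+ 2 by ring.
  by rewrite ww vv; field; rewrite gt_eqF.
rewrite ler_pM2r // ler_pXn2r ?nnegrE //.
by rewrite !mulr_ge0 // ltW.
Qed.

(** * The inequality between [n ^ 11] and [M ^ 7 log n] *)

Section MainBound.
Variables (R : realType) (A : {fset R}).
Local Notation n := #|` A|.
Local Notation S := (sumset A A).
Hypothesis n2 : (1 < n)%N.

Lemma mem_sumset a b : a \in A -> b \in A -> a + b \in S.
Proof. by move=> aA bA; apply: in_imfset2. Qed.

Lemma mem_shift (x a : R) : a \in A -> a + x \in shift A x.
Proof. by move=> aA; apply: in_imfset. Qed.

Lemma mem_prodset (X Y : {fset R}) (a b : R) : a \in X -> b \in Y -> a * b \in prodset X Y.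
Proof. by move=> aX bY; apply: in_imfset2. Qed.

Lemma card_shift (x : R) : #|` shift A x| = n.
Proof. by apply: card_imfset => a b /= /addIr. Qed.

Lemma card_sumset_ge : (n <= #|` S|)%N.
Proof.
have /fset0Pn[a aA] : A != fset0 by rewrite -cardfs_gt0 ltnW.
rewrite -(card_shift a); apply: fsubset_leq_card; apply/fsubsetP => _ /imfsetP[b /= bA ->].
exact: mem_sumset.
Qed.

Lemma main_bound (x y : R) (M : nat) : x != y ->
  (#|` prodset S (shift A x)| <= M)%N -> (#|` prodset S (shift A y)| <= M)%N ->
  n%:R ^+ 11 <= (1448 * 78) ^+ 4 * (1448 * 8) * M%:R ^+ 7 * log2 (n%:R : R).
Proof.
move=> xy Mx My; pose U := shift A x `\ 0.
have U0 : 0 \notin U by rewrite !inE eqxx.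
have UP u : u \in U -> u != 0 /\ u - x \in A.
  by rewrite in_fsetD1 => /andP[u0 /imfsetP[a /= aA e]]; split=> //; rewrite e addrK.
have cU : (n = (0%R \in shift A x) + #|` U|)%N by rewrite -cardfsD1 card_shift.
have Un : (#|` U| <= n)%N by lia.
have nU : (n <= 2 * #|` U|)%N by lia.
(* Zero would give lines of slope 0; dropping it at most halves [S], because [|S| >= n >= 2]. *)
pose S0 := S `\ 0.
have S00 : 0 \notin S0 by rewrite !inE eqxx.
have cS : (#|` S| <= 2 * #|` S0|)%N.
  have := leq_trans n2 card_sumset_ge; rewrite (cardfsD1 0%R S) -/S0.
  by case: (_ \in _) => /=; move: #|` S0| => k; lia.
have SM : (#|` S| <= M)%N.
  have /fset0Pn[u uU] : U != fset0 by rewrite -cardfs_gt0; lia.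
  apply: leq_trans Mx; rewrite -!count_predT.
  apply: (@count_le_inj _ _ _ _ _ _ (fun s => s * u)); first exact: fset_uniq.
    by move=> s s' _ _ /mulIf ->; rewrite // (UP u uU).1.
  by move=> s sS _; rewrite mem_prodset //; move: uU; rewrite in_fsetD1 => /andP[].
pose X t := #|` rich_quotients U t|.
(* Sums of two elements of [U] lie in the translate [S + 2 x], which is as large as [S]. *)
have solymosi t : (X t * t ^ 2 <= 16 * #|` S| ^ 2)%N.
  have cS2 : #|` shift S (x + x)| = #|` S| by apply: card_imfset => a b /= /addIr.
  rewrite -cS2; apply: (@rich_slopes _ U) => // [u v uU vU|r].
    have -> : u + v = (u - x) + (v - x) + (x + x) by ring.
    by apply: in_imfset; apply: mem_sumset; [case: (UP u uU)|case: (UP v vU)].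
  by rewrite in_rich_quotients => /andP[].
have trivial t : (X t * t <= n ^ 2)%N.
  by apply: leq_trans (card_rich_quotients U0 t) _; rewrite leq_exp2r.
have translate t : (1 < t)%N -> (X t * #|` S| * t ^ 3 <= 360 * (n ^ 2 * M ^ 2))%N.
  move=> t1; have yx : y - x != 0 by rewrite subr_eq0 eq_sym.
  have H : (X t * #|` S0| * t ^ 3 <=
      180 * (#|` U| ^ 2 * #|` prodset S (shift A y)| ^ 2))%N.
    apply: (rich_quotients_translate U0 yx t1 S00) => u s /UP[_ uA]; rewrite in_fsetD1.
    move=> /andP[_ sS]; apply: mem_prodset => //.
    by have -> : u + (y - x) = u - x + y by [ring]; apply: mem_shift.
  have H2 : (#|` U| ^ 2 * #|` prodset S (shift A y)| ^ 2 <= n ^ 2 * M ^ 2)%N.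
    by apply: leq_mul; rewrite leq_exp2r.
  have H3 : (X t * #|` S| * t ^ 3 <= 2 * (X t * #|` S0| * t ^ 3))%N.
    have -> : (2 * (X t * #|` S0| * t ^ 3) = X t * (2 * #|` S0|) * t ^ 3)%N by ring.
    by rewrite leq_mul2r leq_mul2l cS !orbT.
  by apply: leq_trans H3 _; move: H H2; lia.
pose B : R := \sum_(1 <= t < n.+1) Num.sqrt (X t)%:R.
have B0 : 0 <= B by apply: sumr_ge0 => t _; apply: sqrtr_ge0.
have nr : 0 < n%:R :> R by rewrite ltr0n ltnW.
have Mr : 0 <= M%:R :> R by [].
(* Here [1448 = 4 * 362]: the 4 comes from squaring [n <= 2 |U|], the 362 from [energy_bound]. *)
have key : n%:R ^+ 3 <= 1448 * M%:R * B.
  have low : ((#|` U| * n ^ 2) ^ 2 <= M * \sum_(1 <= t < n.+1)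
      \sum_(r <- rich_quotients U t) energy A r)%N.
    apply: leq_trans (sum_energy_lower_bound (P := prodset S (shift A x)) U0 Un _) _.
      move=> u b c; rewrite in_fsetD1 mulrC => /andP[_ uA] bA cA.
      by apply: mem_prodset => //; apply: mem_sumset.
    by rewrite leq_mul2r Mx orbT.
  have up : (\sum_(1 <= t < n.+1) \sum_(r <- rich_quotients U t) energy A r)%:R <=
      362 * n%:R ^+ 3 * B :> R.
    rewrite natr_sum /B big_distrr /= big_nat [leRHS]big_nat; apply: ler_sum => t /andP[t0 _].
    apply: energy_bound; first exact: rich_quotients_neq0.
    by apply: leq_trans (trivial t); rewrite leq_pmulr.
  have n6 : (n ^ 6 <= 4 * (#|` U| * n ^ 2) ^ 2)%N.
    have -> : (4 * (#|` U| * n ^ 2) ^ 2 = (2 * #|` U|) ^ 2 * n ^ 4)%N by ring.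
    by rewrite (expnD n 2 4) leq_mul2r leq_exp2r // nU orbT.
  have h := leq_trans n6 (leq_mul (leqnn 4) low).
  rewrite -(ler_nat R) natrX 2!natrM in h.
  have : n%:R ^+ 6 <= 4 * (M%:R * (362 * n%:R ^+ 3 * B)).
    by apply: le_trans h _; rewrite ler_wpM2l // ler_wpM2l.
  have -> : 4 * (M%:R * (362 * n%:R ^+ 3 * B)) = n%:R ^+ 3 * (1448 * M%:R * B) by ring.
  by rewrite (exprD n%:R 3 3) ler_pM2l ?exprn_gt0.
pose s : R := #|` S|%:R.
have s1 : 1 <= s by rewrite ler1n; have := card_sumset_ge; lia.
have sM : s <= M%:R by rewrite ler_nat.
have s0 : 0 < s by lra.
have first : n%:R ^+ 3 <= 1448 * 8 * M%:R * s * log2 (n%:R : R).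
  apply: le_trans key _.
  have : B <= 4 * s * (2 * log2 (n%:R : R)).
    apply: le_trans (ler_wpM2l _ (sum_inv_le R n2)); last by lra.
    apply: sum_sqrt_le_harmonic => [|t _]; first lra.
    by have := solymosi t; rewrite -(ler_nat R) !(natrX, natrM).
  move=> /(ler_wpM2l (_ : 0 <= 1448 * M%:R)) H; apply: le_trans (H _) _; first by rewrite mulr_ge0.
  by rewrite le_eqVlt; apply/orP; left; apply/eqP; ring.
(* The fourth power of [key] is combined with [optimal_split], and [n ^ 4] is cancelled. *)
have second : n%:R ^+ 8 * s <= (1448 * 78) ^+ 4 * M%:R ^+ 6.
  have : B ^+ 4 * s <= 78 ^+ 4 * n%:R ^+ 4 * M%:R ^+ 2.
    apply: optimal_split => // T T0; apply: sum_sqrt_le_split => // [|t _|t t1].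
    - by rewrite divr_ge0 ?mulr_ge0 ?sqr_ge0 // ltW.
    - by have := trivial t; rewrite -(ler_nat R) !(natrX, natrM).
    - rewrite ler_pdivlMr //; have := translate t t1; rewrite -(ler_nat R) !(natrX, natrM) -/s.
      by rewrite mulrAC [in leRHS]mulrA.
  have k4 : (n%:R ^+ 3) ^+ 4 <= (1448 * M%:R * B) ^+ 4.
    by rewrite ler_pXn2r ?nnegrE ?mulr_ge0 ?exprn_ge0.
  move=> /(ler_wpM2l (_ : 0 <= (1448 * M%:R) ^+ 4)) H.
  have {}H : n%:R ^+ 4 * (n%:R ^+ 8 * s) <= n%:R ^+ 4 * ((1448 * 78) ^+ 4 * M%:R ^+ 6).
    have -> : n%:R ^+ 4 * (n%:R ^+ 8 * s) = (n%:R ^+ 3) ^+ 4 * s by ring.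
    have -> : n%:R ^+ 4 * ((1448 * 78) ^+ 4 * M%:R ^+ 6) =
      (1448 * M%:R) ^+ 4 * (78 ^+ 4 * n%:R ^+ 4 * M%:R ^+ 2) :> R by ring.
    apply: le_trans (H _); last by rewrite exprn_ge0 ?mulr_ge0.
    by rewrite mulrA -exprMn ler_wpM2r // ltW.
  by rewrite ler_pM2l ?exprn_gt0 in H.
(* Multiplying [first] by [second] leaves one factor [s] on each side. *)
rewrite -(ler_pM2r s0).
have -> : n%:R ^+ 11 * s = (n%:R ^+ 8 * s) * n%:R ^+ 3 by ring.
have -> : (1448 * 78) ^+ 4 * (1448 * 8) * M%:R ^+ 7 * log2 (n%:R : R) * s =
   ((1448 * 78) ^+ 4 * M%:R ^+ 6) * (1448 * 8 * M%:R * s * log2 (n%:R : R)) by ring.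
by apply: ler_pM => //; rewrite ?mulr_ge0 ?exprn_ge0 // ltW.
Qed.

End MainBound.

(** * Seventh roots and the exceptional shift *)

Lemma powR_ratioX (R : realType) (a : R) (k : nat) : 0 <= a -> (a `^ (k%:R / 7)) ^+ 7 = a ^+ k.
Proof.
by move=> a0; rewrite -powR_mulrn ?powR_ge0 // -powRrM mulfVK ?pnatr_eq0 // powR_mulrn.
Qed.

(** A common bound [M] for two distinct shifts cannot lie below the target, so at most one shift can
    be exceptional. *)
Lemma product_sets_bound (R : realType) (A : {fset R}) (x y : R) (M : nat) : x != y ->
  (#|` prodset (sumset A A) (shift A x)| <= M)%N ->
  (#|` prodset (sumset A A) (shift A y)| <= M)%N ->
  ((1448 * 78) ^+ 4 * (1448 * 8))^-1 *
    (#|` A|%:R `^ (11 / 7) / log2 #|` A|%:R `^ (3 / 7)) <= M%:R :> R.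
Proof.
move=> xy Mx My; have K1 : 1 <= (1448 * 78) ^+ 4 * (1448 * 8) :> R.
  have H : 1 <= 1448 * 78 :> R by lra.
  by have := exprn_ege1 4 H; move: ((1448 * 78) ^+ 4) => z; lra.
have main := main_bound _ xy Mx My.
move: ((1448 * 78) ^+ 4 * (1448 * 8)) K1 main => K K1 main.
have [n2|] := ltnP 1 #|` A|; last first.
  (* Here [log2 1 = 0] and division by [0] make the left-hand side vanish. *)
  case: #|` A| => [|[|//]] _.
    by rewrite mulr0n powR0 ?mul0r ?mulr0 // mulf_neq0 ?invr_eq0 ?pnatr_eq0.
  rewrite mulr1n /log2 ln1 mul0r (@powR0 _ (3 / 7)) ?invr0 ?mulr0 //.
  by rewrite mulf_neq0 ?invr_eq0 ?pnatr_eq0.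
have {}main := main n2; move: #|` A| n2 main => n n2 main.
have L1 : 1 <= log2 (n%:R : R).
  rewrite /log2 ler_pdivlMr ?ln_gt0 ?ltr1n // mul1r ler_ln ?posrE ?(ler_nat R 2 n) //.
  by rewrite ltr0n ltnW.
have K0 : 0 < K by lra.
rewrite mulrC ler_pdivrMr //.
move: (log2 _) L1 main => L L1 main; have L0 : 0 < L by lra.
rewrite -(@ler_pXn2r _ 7) ?nnegrE ?mulr_ge0 ?invr_ge0 ?powR_ge0 //; last exact: ltW.
rewrite expr_div_n (powR_ratioX 11) // (powR_ratioX 3 (ltW L0)) ler_pdivrMr ?exprn_gt0 //.
apply: le_trans main _.
(* The surplus [K ^ 6 L ^ 2] is at least 1, so [K] serves without taking its seventh root and [L]
   may be raised to [L ^ 3]. *)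
have -> : (M%:R * K) ^+ 7 * L ^+ 3 = K * M%:R ^+ 7 * L * (K ^+ 6 * L ^+ 2) by ring.
rewrite ler_peMr ?mulr_ge0 ?exprn_ge0 //; try exact: ltW.
by rewrite mulr_ege1 ?exprn_ege1.
Qed.

Local Open Scope fset_scope.

Theorem theorem2p11 (R : realType) :
  exists c : R, 0 < c /\
  forall A : {fset R}, exists x0 : R, forall x : R, x <> x0 ->
    c * ((#|` A|%:R) `^ (11 / 7) / (log2 (#|` A|%:R)) `^ (3 / 7))
      <= (#|` prodset (sumset A A) (shift A x)|)%:R.
Proof.
set K : R := (1448 * 78) ^+ 4 * (1448 * 8).
exists K^-1; split; first by rewrite invr_gt0 mulr_gt0 ?exprn_gt0 ?mulr_gt0.
move=> A; set V := _ `^ _ / _; pose P x := #|` prodset (sumset A A) (shift A x)|.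
(* A shift violating the bound, if there is one, is the exceptional value: for any other [x] the
   larger of the two products reaches the target, and it cannot be the one at [x0]. Otherwise any
   value will do. *)
have [[x0 bad]|good] := pselect (exists x0, (P x0)%:R < K^-1 * V); last first.
  by exists 0 => x _; rewrite leNgt; apply/negP => bad; apply: good; exists x.
exists x0 => x /eqP xx0; have := product_sets_bound xx0 (leq_maxl (P x) _) (leq_maxr _ (P x0)).
by rewrite -/K -/V; case: leqP => // _ /(lt_le_trans bad); rewrite ltxx.
Qed.
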